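(* The set $\bigcup_{k} N_{2k+1}\setminus N_{2k+2}$ is $\mathcal D_\omega(\mathbf\Pi^0_3)$-complete; that is, it belongs to $\mathcal D_\omega(\mathbf\Pi^0_3)$, and for every $Y\subseteq\{0,1\}^{\mathbb N}$ with $Y\in\mathcal D_\omega(\mathbf\Pi^0_3)$ there is a continuous map $f:\{0,1\}^{\mathbb N}\to\mathbb R$ with $f^{-1}\big(\bigcup_k N_{2k+1}\setminus N_{2k+2}\big)=Y$.
   Context: $\{0,1\}^{\mathbb N}$ carries the product of the discrete topology. A set is $\mathbf\Pi^0_3$ if it has the form $\bigcap_{m}\bigcup_{n}F_{m,n}$ with each $F_{m,n}$ closed. A set is in $\mathcal D_\omega(\mathbf\Pi^0_3)$ if it has the form $\bigcup_k A_{2k+1}\setminus A_{2k+2}$, where $A_1\supseteq A_2\supseteq\cdots$ are $\mathbf\Pi^0_3$ sets. A set $X\in\Gamma$ is $\Gamma$-complete iff every $Y\subseteq\{0,1\}^{\mathbb N}$ with $Y\in\Gamma$ is a continuous preimage of $X$. For finite binary strings $\alpha,\sigma$ with $|\alpha|\le|\sigma|$, $d_\alpha(\sigma)$ is the number of $i<|\sigma|-|\alpha|$ such that the initial segment of $\sigma$ of length $i+|\alpha|$ ends with $\alpha$, divided by $|\sigma|$. For $x\in\{0,1\}^{\mathbb N}$ and $a\in\mathbb Z$, $a\,.\,x=a+\sum_{n\ge0}x(n)2^{-(n+1)}$, and $x\upharpoonright s=(x(0),\dots,x(s-1))$. A real $a\,.\,x$ is order-$k$ normal in base $2$ iff for each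 $\alpha\in\{0,1\}^k$, $\lim_{s\to\infty}d_\alpha(x\upharpoonright s)=2^{-k}$. $N_k$ is the set of all order-$k$ normal numbers in $[0,1]$; the union ranges over $k\in\mathbb N$. *)

(* Defs.v *)
From HB Require Import structures.
From mathcomp Require Import all_boot all_order all_algebra.
From mathcomp Require Import all_classical all_reals all_analysis.

Set Implicit Arguments.
Unset Strict Implicit.
Unset Printing Implicit Defensive.

Import Order.TTheory GRing.Theory Num.Theory.
Import numFieldNormedType.Exports.

Local Open Scope classical_set_scope.
Local Open Scope ring_scope.

Definition Pi03 (T : topologicalType) (A : set T) : Prop :=
  exists F : nat -> nat -> set T,
    (forall m n, closed (F m n)) /\ A = \bigcap_m \bigcup_n F m n.

(* The sets are indexed from 1: the value A 0 is unconstrained and unused. *)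
Definition Domega_Pi03 (T : topologicalType) (X : set T) : Prop :=
  exists A : nat -> set T,
    [/\ forall k, (0 < k)%N -> Pi03 (A k),
        forall k, (0 < k)%N -> A k.+1 `<=` A k
      & X = \bigcup_k (A (2 * k + 1)%N `\` A (2 * k + 2)%N)].

Definition complete_for
    (Gamma : forall T : topologicalType, set T -> Prop)
    (T : topologicalType) (X : set T) : Prop :=
  Gamma T X /\
  forall Y : set cantor_space, Gamma cantor_space Y ->
    exists f : cantor_space -> T, continuous f /\ f @^-1` X = Y.

(* The offset i stops strictly below |sigma| - |alpha|, so an occurrence of
   alpha at the very end of sigma is not counted. *)
Definition occ_density (R : realType) (alpha sigma : seq bool) : R :=
  (\sum_(i < size sigma - size alpha)
      suffix alpha (take (i + size alpha) sigma))%N%:R / (size sigma)%:R.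

Definition restr (x : cantor_space) (s : nat) : seq bool := mkseq x s.

Definition binary_real (R : realType) (a : int) (x : cantor_space) : R :=
  a%:~R + limn (series (fun n => (x n)%:R * 2^-1 ^+ n.+1 : R)).

(* Only dyadic rationals have two expansions a . x.  Both are eventually
   constant, so neither satisfies the limit condition when k > 0, while every
   expansion does when k = 0; hence "for some expansion" and "for every
   expansion" agree. *)
Definition order_normal (R : realType) (k : nat) (r : R) : Prop :=
  exists (a : int) (x : cantor_space),
    r = binary_real R a x /\
    forall alpha : k.-tuple bool,
      occ_density R alpha (restr x s) @[s --> \oo] --> (2^-1 ^+ k : R).

Definition order_normal_set (R : realType) (k : nat) : set R :=
  [set r | 0 <= r <= 1 /\ order_normal k r].

Arguments order_normal_set : clear implicits.

(* Main.v *)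
Require Import Defs.
From mathcomp Require Import all_boot all_order all_algebra.
From mathcomp Require Import all_classical all_reals all_analysis.
From mathcomp Require Import zify ring lra.
Import Order.TTheory GRing.Theory Num.Theory.
Import numFieldNormedType.Exports.
Set Implicit Arguments.
Unset Strict Implicit.
Unset Printing Implicit Defensive.

(* Hardness: given decreasing sets A_k, each an intersection over m of unions over
   i of closed sets F d m i (d = k - 1), a single continuous map y |-> x sends y to
   an order-k normal sequence iff y is in A_k, for all k > 0 at once.  The digits of
   x are written in stages, so long that each dwarfs its past but built from periods
   short compared to that past.  In a neutral stage, all words of length s + 1 are
   listed, which makes short patterns nearly equidistributed.  When y is seen to
   leave one more of the sets F d m i, one stage replaces a proportion 2^-m of its
   words by words of period d: patterns of length at most d stay equidistributed
   but the pattern 0^d 1 becomes too rare by an amount depending on (d, m) only.  So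
   infinitely many events (d, m) destroy order-(d+1) normality, whereas finitely
   many for each m with d < k leave order-k normality intact.
   Membership: r is order-k normal iff, for each tolerance, the density condition
   holds from some rank on for some expansion of r.  For fixed tolerance and rank the
   expansions form a compact set, with closed image in R.  A small tolerance excludes
   eventually constant expansions, so all tolerances share the same expansion. *)

(** * Block construction of digit sequences *)

Local Open Scope nat_scope.

Definition occurs (alpha : seq bool) (x : nat -> bool) (i : nat) : bool :=
  mkseq (fun a => x (i + a)) (size alpha) == alpha.

Lemma occursP alpha x i :
  reflect (forall a, a < size alpha -> x (i + a) = nth false alpha a)
          (occurs alpha x i).
Proof.
apply: (iffP eqP) => [<- a|xE].
  by rewrite size_mkseq => aj; rewrite nth_mkseq.
apply: (@eq_from_nth _ false); rewrite size_mkseq // => a aj.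
by rewrite nth_mkseq // xE.
Qed.

Lemma eq_occurs alpha x y i i' :
  (forall a, a < size alpha -> x (i + a) = y (i' + a)) ->
  occurs alpha x i = occurs alpha y i'.
Proof.
by move=> xy; apply/occursP/occursP => H a aj; rewrite -H ?xy.
Qed.

(** The functions form a product family: a coordinate in the image of [rho] has one admissible
    value, and every other coordinate has two. *)
Lemma card_ffun_prescribed (I : finType) j (rho : 'I_j -> I) (beta : 'I_j -> bool) :
  injective rho ->
  #|[set u : {ffun I -> bool} | [forall a, u (rho a) == beta a]]| = 2 ^ (#|I| - j).
Proof.
move=> rho_inj.
pose F i := [pred b | [forall a, (rho a == i) ==> (b == beta a)]].
have -> : #|[set u : {ffun I -> bool} | [forall a, u (rho a) == beta a]]|
    = #|family F|.
  apply: eq_card => u; rewrite inE; apply/forallP/familyP => H i.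
    by apply/forallP => a; apply/implyP => /eqP <-.
  by have := H (rho i) => /forallP /(_ i) /implyP; apply.
rewrite card_family foldrE big_map big_enum /=.
rewrite (bigID (mem (codom rho))) /= big1 ?mul1n; last first.
  move=> i /codomP[a ->]; rewrite -(card1 (beta a)); apply: eq_card => b.
  rewrite !inE; apply/forallP/eqP => [/(_ a)|-> a']; first by rewrite eqxx => /eqP.
  by apply/implyP => /eqP /rho_inj ->.
rewrite (eq_bigr (fun=> 2)) ?prod_nat_const => [|i icodom].
  congr (_ ^ _); have := cardC (mem (codom rho)).
  rewrite card_codom // card_ord => <-; rewrite addKn.
  by apply: eq_card => i; rewrite !inE.
rewrite -card_bool; apply: eq_card => b; rewrite !inE.
apply/forallP => a; apply/implyP => /eqP ai.
by rewrite -ai codom_f in icodom.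
Qed.

Definition word (n : nat) := {ffun 'I_n.+1 -> bool}.

(* The word of period d generated by u; for d = 0 it is constantly false, which
   is the right biased word for patterns of length d + 1 = 1. *)
Definition letter n (d : nat) (u : word n) (t : nat) : bool :=
  (0 < d) && u (inord (t %% d)).

(** Since [size alpha <= d], the positions of the occurrence are distinct modulo [d], so the pattern
    fixes that many distinct coordinates of [u]. A word of period [d] is thus exactly fair for
    patterns no longer than [d]. *)
Lemma card_occurs_letter n d t (alpha : seq bool) :
  0 < size alpha <= d -> t + size alpha <= n.+1 ->
  #|[set u : word n | occurs alpha (letter d u) t]| = 2 ^ (n.+1 - size alpha).
Proof.
move=> /andP[j0 jd] tj; have d0 : 0 < d by exact: leq_trans jd.
pose rho (a : 'I_(size alpha)) : 'I_n.+1 := inord ((t + a) %% d).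
have rhoE (a : 'I_(size alpha)) : rho a = (t + a) %% d :> nat.
  rewrite inordK // (leq_ltn_trans (leq_mod _ _)) //.
  by apply: leq_trans tj; rewrite ltn_add2l.
have rho_inj : injective rho.
  move=> a b /(congr1 (@nat_of_ord _)); rewrite !rhoE => /eqP.
  rewrite eqn_modDl !modn_small; first by move/eqP/val_inj.
  - exact: leq_trans (ltn_ord b) jd.
  - exact: leq_trans (ltn_ord a) jd.
rewrite -[n.+1 in RHS]card_ord -(card_ffun_prescribed (nth false alpha) rho_inj).
apply: eq_card => u; rewrite !inE; apply/occursP/forallP => H a.
  by rewrite -H // /letter d0.
move=> aj; have /eqP <- := H (Ordinal aj).
by rewrite /letter d0.
Qed.

(** Periodicity makes the letters at [t] and [t + d] equal, while the pattern starts with false and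
    ends with true; for [d = 0] the word is constantly false. *)
Lemma occurs_letter_short n d t (u : word n) :
  occurs (rcons (nseq d false) true) (letter d u) t = false.
Proof.
apply/negP => /occursP; rewrite size_rcons size_nseq => H.
have := H d (ltnSn d); rewrite nth_rcons size_nseq ltnn eqxx /letter modnDr.
case: d H => [|d] H //=.
by have := H 0 isT; rewrite nth_rcons size_nseq /= addn0 /letter /= => ->.
Qed.

(* The first component only selects which blocks of a stage are biased, see gap. *)
Definition blocks (s : nat) := ('I_(2 ^ s.+1) * word s)%type.

Lemma card_blocks s : #|{: blocks s}| = 2 ^ s.+1 * 2 ^ s.+1.
Proof. by rewrite card_prod card_ord card_ffun card_bool card_ord. Qed.

Lemma blocks_gt0 s : 0 < #|{: blocks s}|.
Proof. by rewrite card_blocks muln_gt0 !expn_gt0. Qed.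

Definition period (s : nat) := s.+1 * #|{: blocks s}|.

Lemma period_gt0 s : 0 < period s.
Proof. by rewrite muln_gt0 blocks_gt0. Qed.

(* The factors make period s divide both start s and start s.+1, so that stage s
   consists of whole periods starting at phase 0. *)
Definition start (s : nat) := \prod_(r < s.+1) (r.+1 * period r).

Lemma startS s : start s.+1 = start s * (s.+2 * period s.+1).
Proof. by rewrite /start big_ord_recr. Qed.

Lemma start_gt0 s : 0 < start s.
Proof. by apply: prodn_gt0 => r; rewrite muln_gt0 period_gt0. Qed.

Lemma leq_period_start s : s.+1 * period s <= start s.
Proof.
by rewrite /start big_ord_recr /= leq_pmull // prodn_gt0 // => r;
  rewrite muln_gt0 period_gt0.
Qed.

Lemma leq_start_startS s : s.+2 * start s <= start s.+1.
Proof.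
by rewrite startS mulnC leq_pmul2l ?start_gt0 // leq_pmulr ?period_gt0.
Qed.

Lemma period_dvd_start s : period s %| start s.
Proof. by rewrite /start big_ord_recr /= mulnA dvdn_mull. Qed.

Lemma period_dvd_startS s : period s %| start s.+1.
Proof. by rewrite startS dvdn_mulr // period_dvd_start. Qed.

Lemma ltn_start s : s < start s.
Proof.
by rewrite (leq_trans _ (leq_period_start s)) // leq_pmulr ?period_gt0.
Qed.

Lemma leq_start s r : s <= r -> start s <= start r.
Proof.
move=> /subnK <-; elim: (r - s) => // k IH; rewrite (leq_trans IH) //.
by rewrite addSn (leq_trans _ (leq_start_startS _)) ?leq_pmull.
Qed.

(** * Stages and the digit sequence *)

(** The number of thresholds [start 1], [start 2], ... that are at most [i]. Bounding the index by
    [i] loses none of them, because [s < start s]. *)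
Definition stage (i : nat) := \sum_(s < i) (start s.+1 <= i).

Lemma stageE s i : start s <= i < start s.+1 -> stage i = s.
Proof.
move=> /andP[si iS]; have s_lt_i : s <= i.
  by apply: leq_trans si; exact/ltnW/ltn_start.
rewrite /stage -(big_mkord xpredT (fun s => (start s.+1 <= i) : nat)).
rewrite (@big_cat_nat _ _ _ s) //= big_nat_cond (eq_bigr (fun=> 1)); last first.
  move=> r; rewrite andbT => rs.
  by rewrite (leq_trans (leq_start _) si).
rewrite -big_nat_cond sum_nat_const_nat muln1 subn0 big_nat_cond big1 ?addn0 //.
move=> r /andP[/andP[sr _] _].
by rewrite leqNgt (leq_trans iS) // leq_start.
Qed.

Lemma stage_exists i : start 0 <= i -> exists s, start s <= i < start s.+1.
Proof.
move=> i0; have ex : exists s, i < start s.+1.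
  by exists i; apply: ltn_trans (ltn_start _).
case: (ex_minnP ex) => -[|s] iS min; [exists 0|exists s.+1]; rewrite iS andbT //.
by rewrite leqNgt; apply/negP => /min; rewrite ltnn.
Qed.

(** The value [s.+1] is the length of a block, so such a word does not repeat inside its block. An
    event [(d, m)] with [m <= s.+1] shortens the period to [d] for a proportion 2^-m of the first
    components. *)
Definition gap s (o : option (nat * nat)) (c : 'I_(2 ^ s.+1)) : nat :=
  if o is Some (d, m) then if c < 2 ^ (s.+1 - m) then d else s.+1 else s.+1.

Definition block_at s i : blocks s :=
  enum_val (Ordinal (ltn_pmod (i %/ s.+1) (blocks_gt0 s))).

Definition digits (e : nat -> option (nat * nat)) (i : nat) : bool :=
  let s := stage i in let v := block_at s i in
  letter (gap (e s) v.1) v.2 (i %% s.+1).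

(** Grouping positions by their offset in the block is what makes counting possible: at a fixed
    offset, the blocks of one period run through all words. *)
Lemma sum_nat_block (F : nat -> nat) M N :
  \sum_(0 <= i < M * N) F i = \sum_(0 <= t < N) \sum_(0 <= v < M) F (v * N + t).
Proof.
rewrite exchange_big_nat /=.
elim: M => [|M IH]; first by rewrite !big_geq.
rewrite big_nat_recr //= -IH mulSn (@big_cat_nat _ _ _ (M * N)) //= ?leq_addl //.
congr (_ + _); rewrite -{1}[M * N]add0n big_addn addnK.
by apply: eq_bigr => t _; rewrite addnC.
Qed.

(** Here [h t] counts the occurrences that start at offset [t] of a block. If the pattern fits in
    the rest of the block, this is a count over all words; if it runs into the next block, only the
    trivial bound is kept. *)
Lemma sum_atom_occurs e s q alpha :
  start s <= q * period s -> q.+1 * period s <= start s.+1 ->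
  exists2 h : nat -> nat,
    \sum_(q * period s <= i < q.+1 * period s) occurs alpha (digits e) i =
      \sum_(0 <= t < s.+1) h t &
    forall t, h t <= #|{: blocks s}| /\
    (t + size alpha <= s.+1 -> h t =
      \sum_(c : 'I_(2 ^ s.+1))
         #|[set u : word s | occurs alpha (letter (gap (e s) c) u) t]|).
Proof.
move=> q1 q2.
exists (fun t => \sum_(0 <= v < #|{: blocks s}|)
   occurs alpha (digits e) (q * period s + (v * s.+1 + t))).
  rewrite -(sum_nat_block (fun i => occurs alpha (digits e) (q * period s + i))).
  rewrite mulSn -{1}[q * _]add0n big_addn addnK [#|_| * _]mulnC.
  by apply: eq_bigr => i _; rewrite addnC.
move=> t; split.
  rewrite big_mkord (@leq_trans (\sum_(v < #|{: blocks s}|) 1)) //.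
    by apply: leq_sum => v _; exact: leq_b1.
  by rewrite sum1_card card_ord.
move=> tj.
transitivity (\sum_(v : blocks s)
    occurs alpha (letter (gap (e s) v.1) v.2) t); last first.
  rewrite -(pair_bigA _ (fun c u =>
    (occurs alpha (letter (gap (e s) c) u) t : nat))) /=.
  apply: eq_bigr => c _; rewrite -sum1_card [RHS]big_mkcond /=.
  by apply: eq_bigr => u _; rewrite inE; case: occurs.
rewrite big_enum_val big_mkord; apply: eq_bigr => v _; congr (nat_of_bool _).
apply: eq_occurs => a aj.
have ta : t + a < s.+1 by apply: leq_trans tj; rewrite ltn_add2l.
have iE : q * period s + (v * s.+1 + t) + a
        = (q * #|{: blocks s}| + v) * s.+1 + (t + a).
  by rewrite /period; lia.
have st : stage (q * period s + (v * s.+1 + t) + a) = s.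
  apply: stageE; rewrite -!addnA (leq_trans q1) ?leq_addr //=.
  apply: leq_trans q2; rewrite mulSn addnC ltn_add2r /period.
  have := ltn_ord v; move: (nat_of_ord v) => w.
  by move/leq_mul => /(_ _ _ (leqnn s.+1)); lia.
rewrite /digits st /block_at iE.
set w := Ordinal _; have -> : w = v.
  apply: val_inj => /=; rewrite divnMDl // (divn_small ta) addn0.
  by rewrite modnMDl modn_small.
by rewrite modnMDl (modn_small ta).
Qed.

Lemma sum_ord_lt n k : k <= n -> \sum_(c < n) (c < k) = k.
Proof.
move=> kn; rewrite -(big_mkord xpredT (fun c => (c < k) : nat)).
rewrite (@big_cat_nat _ _ _ k) //= [X in _ + X](_ : _ = 0).
  rewrite addn0 big_nat_cond (eq_bigr (fun=> 1)) => [|i /andP[/andP[_ ->]]] //.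
  by rewrite -big_nat_cond sum_nat_const_nat subn0 muln1.
rewrite big_nat_cond big1 // => i /andP[/andP[ki _] _].
by rewrite ltnNge ki.
Qed.

Lemma sum_overflow n j : \sum_(0 <= t < n) (n < t + j) <= j.
Proof.
rewrite (@big_cat_nat _ _ _ (n - j)) ?leq_subr //= big_nat_cond big1 => [|i].
  rewrite add0n (@leq_trans (\sum_(n - j <= i < n) 1)) //.
    by apply: leq_sum => i _; exact: leq_b1.
  by rewrite sum_nat_const_nat muln1; lia.
by case/andP => /andP[_ ij] _; rewrite ltnNge; suff -> : i + j <= n by []; lia.
Qed.

(** A first component gives an inexact count only if its period [d] is below [size alpha]. Then
    [M <= m], so at most [2 ^ (s.+1 - M)] components are concerned, each with an error of at most
    [2 ^ s.+1]. *)
Lemma count_good_block s o M t (alpha : seq bool) :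
  0 < size alpha -> t + size alpha <= s.+1 ->
  (forall d m, o = Some (d, m) -> d < size alpha -> M <= m) ->
  let X := \sum_(c : 'I_(2 ^ s.+1))
     #|[set u : word s | occurs alpha (letter (gap o c) u) t]| in
  let Y := 2 ^ s.+1 * 2 ^ (s.+1 - size alpha) in
  let E := 2 ^ (s.+1 - M) * 2 ^ s.+1 in
  X <= Y + E /\ Y <= X + E.
Proof.
move=> j0 tj oM /=.
have EE : 2 ^ (s.+1 - M) * 2 ^ s.+1
        = \sum_(c < 2 ^ s.+1) (c < 2 ^ (s.+1 - M)) * 2 ^ s.+1.
  by rewrite -big_distrl /= sum_ord_lt // leq_exp2l // leq_subr.
have YE : 2 ^ s.+1 * 2 ^ (s.+1 - size alpha)
        = \sum_(c < 2 ^ s.+1) 2 ^ (s.+1 - size alpha).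
  by rewrite sum_nat_const card_ord.
have cP (c : 'I_(2 ^ s.+1)) : size alpha <= gap o c \/ c < 2 ^ (s.+1 - M).
  rewrite /gap; case: o oM => [[d m]|] oM; last by left; lia.
  case: ifP => cm; last by left; lia.
  have [jd|dj] := leqP (size alpha) d; [by left|right].
  apply: leq_trans cm _; rewrite leq_exp2l // leq_sub2l //.
  exact: oM dj.
rewrite EE YE -!big_split /=; split; apply: leq_sum => c _.
  have [jc|->] := cP c; first by rewrite card_occurs_letter ?j0 ?jc //; lia.
  rewrite mul1n; apply: leq_trans (leq_addl _ _).
  by rewrite (leq_trans (max_card _)) // card_ffun card_bool card_ord.
have [jc|->] := cP c; first by rewrite card_occurs_letter ?j0 ?jc //; lia.
by rewrite mul1n (leq_trans _ (leq_addl _ _)) // leq_exp2l // leq_subr.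
Qed.

(** The components of period [d] contribute no occurrence at all and the others the exact fair
    share, so the deficit is known exactly. *)
Lemma count_bad_block s d m t :
  let alpha := rcons (nseq d false) true in
  t + d.+1 <= s.+1 ->
  \sum_(c : 'I_(2 ^ s.+1))
     #|[set u : word s | occurs alpha (letter (gap (Some (d, m)) c) u) t]| +
   2 ^ (s.+1 - m) * 2 ^ (s.+1 - d.+1) = 2 ^ s.+1 * 2 ^ (s.+1 - d.+1).
Proof.
move=> alpha td; have ja : size alpha = d.+1 by rewrite size_rcons size_nseq.
have -> : 2 ^ (s.+1 - m) * 2 ^ (s.+1 - d.+1)
        = \sum_(c < 2 ^ s.+1) (c < 2 ^ (s.+1 - m)) * 2 ^ (s.+1 - d.+1).
  by rewrite -big_distrl /= sum_ord_lt // leq_exp2l // leq_subr.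
have -> : 2 ^ s.+1 * 2 ^ (s.+1 - d.+1) = \sum_(c < 2 ^ s.+1) 2 ^ (s.+1 - d.+1).
  by rewrite sum_nat_const card_ord.
rewrite -big_split /=; apply: eq_bigr => c _; rewrite /gap; case: ifP => cm.
  rewrite mul1n (_ : #|_| = 0) //; apply: eq_card0 => u.
  by rewrite inE occurs_letter_short.
by rewrite mul0n addn0 card_occurs_letter ja //; lia.
Qed.

Local Open Scope ring_scope.

(** * Deviation from equidistribution over one period *)

Lemma natr_exp_sub (R : realType) n k : (k <= n)%N ->
  (2 ^ (n - k))%:R = (2 ^ n)%:R * 2^-1 ^+ k :> R.
Proof.
move=> kn; rewrite -{2}(subnK kn) expnD natrM -mulrA !natrX exprVn.
by rewrite mulfV ?mulr1 ?expf_neq0 ?pnatr_eq0.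
Qed.

(** Only the start of an occurrence has to lie in the interval, so the deviation is additive over
    adjacent intervals. *)
Definition deviation (R : realType) (alpha : seq bool) (x : nat -> bool)
    (m n : nat) : R :=
  \sum_(m <= i < n) ((occurs alpha x i)%:R - 2^-1 ^+ size alpha).

Lemma deviation_le (R : realType) alpha x m n :
  `|deviation R alpha x m n| <= (n - m)%:R.
Proof.
rewrite (le_trans (ler_norm_sum _ _ _)) //.
rewrite -[leRHS]mulr1 mulr_natl -sumr_const_nat; apply: ler_sum => i _.
have h0 : 0 <= 2^-1 ^+ size alpha :> R by rewrite exprn_ge0.
have h1 : 2^-1 ^+ size alpha <= 1 :> R by rewrite exprn_ile1 // invf_le1 ?ler1n.
move: h0 h1; set h := _ ^+ _ => h0 h1.
by case: occurs; rewrite ler_norml /=; apply/andP; split; lra.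
Qed.

Lemma deviation_cat (R : realType) alpha x m n p : (m <= n <= p)%N ->
  deviation R alpha x m p = deviation R alpha x m n + deviation R alpha x n p.
Proof. by move=> /andP[mn np]; rewrite /deviation (@big_cat_nat _ _ _ n). Qed.

Lemma deviation_atom (R : realType) e s q alpha :
  (start s <= q * period s)%N -> (q.+1 * period s <= start s.+1)%N ->
  exists2 h : nat -> nat,
    deviation R alpha (digits e) (q * period s) (q.+1 * period s) =
      \sum_(0 <= t < s.+1)
         ((h t)%:R - #|{: blocks s}|%:R * 2^-1 ^+ size alpha) &
    forall t, (h t <= #|{: blocks s}|)%N /\
    ((t + size alpha <= s.+1)%N -> h t =
      \sum_(c : 'I_(2 ^ s.+1))
         #|[set u : word s | occurs alpha (letter (gap (e s) c) u) t]|)%N.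
Proof.
move=> q1 q2; have [h hE hP] := sum_atom_occurs e alpha q1 q2.
exists h => //; rewrite /deviation !sumrB -!natr_sum hE; congr (_ - _).
by rewrite !sumr_const_nat subn0 mulSn addnK /period mulnC mulrnA mulr_natl.
Qed.

(** The term [2^-1 ^+ M] pays for the biased blocks, and the other term for the at most [size alpha]
    offsets per block at which the pattern crosses into the next block. *)
Lemma good_atom (R : realType) e s q alpha M :
  (start s <= q * period s)%N -> (q.+1 * period s <= start s.+1)%N ->
  (0 < size alpha <= s.+1)%N -> (M <= s.+1)%N ->
  (forall d m, e s = Some (d, m) -> (d < size alpha)%N -> (M <= m)%N) ->
  `|deviation R alpha (digits e) (q * period s) (q.+1 * period s)| <=
  (period s)%:R * (2^-1 ^+ M + (size alpha)%:R / s.+1%:R).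
Proof.
move=> q1 q2 /andP[j0 js] Ms eM; have [h -> hP] := deviation_atom R e alpha q1 q2.
set B := #|_|; set j := size alpha.
have h0 : 0 <= 2^-1 ^+ j :> R by rewrite exprn_ge0.
have h1 : 2^-1 ^+ j <= 1 :> R by rewrite exprn_ile1 // invf_le1 ?ler1n.
have M0 : 0 <= 2^-1 ^+ M :> R by rewrite exprn_ge0.
rewrite (le_trans (ler_norm_sum _ _ _)) //.
have : \sum_(0 <= t < s.+1) `|(h t)%:R - B%:R * 2^-1 ^+ j| <=
  \sum_(0 <= t < s.+1) (B%:R * 2^-1 ^+ M + B%:R * (s.+1 < t + j)%N%:R) :> R.
  apply: ler_sum => t _; have [hB hE] := hP t.
  have Bge : 0 <= B%:R :> R by [].
  have hB' : (h t)%:R <= B%:R :> R by rewrite ler_nat.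
  have hge : 0 <= (h t)%:R :> R by [].
  have [tj|tj] := leqP (t + j) s.+1.
    have := count_good_block j0 tj eM; rewrite -hE // -/j => /= -[].
    rewrite -!(ler_nat R) !natrD !natrM.
    rewrite !natr_exp_sub // mulr0 addr0 ler_norml.
    have -> : B%:R = (2 ^ s.+1)%:R * (2 ^ s.+1)%:R :> R.
      by rewrite /B card_blocks natrM.
    set P := (2 ^ s.+1)%:R : R.
    rewrite !mulrA [P * _ * P]mulrAC => a b; apply/andP; split; lra.
  rewrite mulr1; move: h0 h1 M0; set u := _ ^+ j; set v := _ ^+ M => h0 h1 M0.
  have Bu0 : 0 <= B%:R * u by rewrite mulr_ge0.
  have Bu1 : B%:R * u <= B%:R by rewrite ler_piMr.
  have Bv0 : 0 <= B%:R * v by rewrite mulr_ge0.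
  by rewrite ler_norml; apply/andP; split; lra.
move/le_trans; apply; rewrite big_split /= sumr_const_nat subn0 -mulr_sumr -natr_sum.
rewrite mulrDr /period natrM lerD //.
  by rewrite -/B -[leLHS]mulr_natl mulrA.
rewrite -/B [s.+1%:R * _]mulrC -mulrA [s.+1%:R * _]mulrCA divff // mulr1 ler_wpM2l //.
by rewrite ler_nat sum_overflow.
Qed.

Lemma bad_atom (R : realType) e s q d m :
  let alpha := rcons (nseq d false) true in
  (start s <= q * period s)%N -> (q.+1 * period s <= start s.+1)%N ->
  (d <= s)%N -> (m <= s.+1)%N -> e s = Some (d, m) ->
  deviation R alpha (digits e) (q * period s) (q.+1 * period s) <=
  (period s)%:R * (2 * d.+1%:R / s.+1%:R - 2^-1 ^+ (m + d.+1)).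
Proof.
move=> alpha q1 q2 ds ms es; have [h -> hP] := deviation_atom R e alpha q1 q2.
have ja : size alpha = d.+1 by rewrite size_rcons size_nseq.
rewrite ja in hP *; set B := #|_|; set j := d.+1.
have h0 : 0 <= 2^-1 ^+ j :> R by rewrite exprn_ge0.
have h1 : 2^-1 ^+ j <= 1 :> R by rewrite exprn_ile1 // invf_le1 ?ler1n.
have M0 : 0 <= 2^-1 ^+ m :> R by rewrite exprn_ge0.
have M1 : 2^-1 ^+ m <= 1 :> R by rewrite exprn_ile1 // invf_le1 ?ler1n.
(* At an offset where the pattern overflows, the summand is at most [B], and the deficit subtracted
   there by the uniform bound is again at most [B]; hence the factor 2. *)
have : \sum_(0 <= t < s.+1) ((h t)%:R - B%:R * 2^-1 ^+ j) <=
  \sum_(0 <= t < s.+1) (2 * (B%:R * (s.+1 < t + j)%N%:R)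
      - B%:R * (2^-1 ^+ (m + j))) :> R.
  rewrite exprD; apply: ler_sum => t _; have [hB hE] := hP t.
  have Bge : 0 <= B%:R :> R by [].
  have hB' : (h t)%:R <= B%:R :> R by rewrite ler_nat.
  have [tj|tj] := leqP (t + j) s.+1.
    have := count_bad_block m tj; rewrite -/alpha -es -hE // => /(congr1 (fun n => n%:R : R)).
    rewrite natrD !natrM !natr_exp_sub // !mulr0.
    have -> : B%:R = (2 ^ s.+1)%:R * (2 ^ s.+1)%:R :> R.
      by rewrite /B card_blocks natrM.
    set P := (2 ^ s.+1)%:R : R; set u := _ ^+ _; set v := _ ^+ _; lra.
  rewrite mulr1; set u := _ ^+ m in M0 M1 *; set v := _ ^+ j in h0 h1 *.
  have : 0 <= B%:R * v by rewrite mulr_ge0.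
  have : B%:R * (u * v) <= B%:R by rewrite ler_piMr // mulr_ile1.
  by lra.
move/le_trans; apply; rewrite big_split /= sumr_const_nat subn0 -!mulr_sumr -natr_sum.
rewrite mulrBr /period natrM -/B lerD //; last first.
  by rewrite -[leLHS]mulr_natl mulrN lerN2 mulrA.
have : s.+1%:R != 0 :> R by [].
set n := s.+1%:R; set b := B%:R; set k := j%:R => n0.
have -> : n * b * (2 * k / n) = 2 * (b * k) by field.
by rewrite ler_wpM2l // ler_wpM2l // ler_nat sum_overflow.
Qed.

Local Open Scope classical_set_scope.

(** * Accumulation over periods and stages *)

Lemma deviation0D (R : realType) alpha x m n : (m <= n)%N ->
  deviation R alpha x 0 n = deviation R alpha x 0 m + deviation R alpha x m n.
Proof. by move=> mn; rewrite (@deviation_cat _ _ _ _ m). Qed.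

Lemma atoms_le (R : realType) (G : nat -> R) (eps : R) s :
  (forall q, (start s <= q * period s)%N -> (q.+1 * period s <= start s.+1)%N ->
    G (q.+1 * period s)%N <= G (q * period s)%N + eps * (period s)%:R) ->
  forall q, (start s <= q * period s <= start s.+1)%N ->
    G (q * period s)%N <=
      G (start s) + eps * ((q * period s)%:R - (start s)%:R).
Proof.
move=> GS; have /dvdnP[q0 q0E] := period_dvd_start s.
move=> q /andP[sq]; have q0q : (q0 <= q)%N.
  by rewrite -(leq_pmul2r (period_gt0 s)) -q0E.
rewrite -(subnKC q0q); elim: (q - q0)%N => [|k IH] qS.
  by rewrite addn0 -q0E subrr mulr0 addr0.
rewrite addnS in qS *.
have qS' : ((q0 + k) * period s <= start s.+1)%N.
  by apply: leq_trans qS; rewrite leq_mul2r leqnSn orbT.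
have q0k : (start s <= (q0 + k) * period s)%N.
  by rewrite q0E leq_mul2r leq_addr orbT.
rewrite (le_trans (GS _ q0k qS)) // (le_trans (lerD (IH qS') (lexx _))) //.
by rewrite mulSn natrD -addrA -mulrDr lerD // [leRHS]mulrBr mulrDr mulrBr; lra.
Qed.

(** Each stage begins and ends at a multiple of its own period, so the increments over single
    periods chain across stages without a remainder. *)
Lemma stages_le (R : realType) (G : nat -> R) (eps : R) s0 :
  (forall s q, (s0 <= s)%N -> (start s <= q * period s)%N ->
    (q.+1 * period s <= start s.+1)%N ->
    G (q.+1 * period s)%N <= G (q * period s)%N + eps * (period s)%:R) ->
  forall s q, (s0 <= s)%N -> (start s <= q * period s <= start s.+1)%N ->
    G (q * period s)%N <=
      G (start s0) + eps * ((q * period s)%:R - (start s0)%:R).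
Proof.
move=> GS s q s0s; rewrite -(subnKC s0s); elim: (s - s0)%N q => [|k IH] q.
  by rewrite addn0; apply: atoms_le => q'; exact: GS.
move=> /(@atoms_le R G eps _ (fun q' => GS _ q' (leq_addr _ _))) H.
apply: le_trans H _.
have /dvdnP[q1 q1E] := period_dvd_startS (s0 + k).
have := IH q1; rewrite -q1E leqnn andbT => /(_ (leq_start (leqnSn _))).
by rewrite addnS; set g := G (start _); lra.
Qed.

(** This is u(n) = o(n). *)
Definition smallo (R : realType) (u : nat -> R) : Prop :=
  forall eta, 0 < eta -> \forall n \near \oo, `|u n| <= eta * n%:R.

Lemma near_half_expn (R : realType) (eta : R) : 0 < eta ->
  \forall n \near \oo, 2^-1 ^+ n <= eta.
Proof.
move=> eta0; have h : `|2^-1 : R| < 1 by rewrite ger0_norm // invf_lt1 // ltr1n.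
have /cvgrPdist_le /(_ _ eta0) := cvg_expr h.
by apply: filterS => n; rewrite sub0r normrN ger0_norm // exprn_ge0.
Qed.

Lemma near_divS (R : realType) (a eta : R) : 0 < eta ->
  \forall n \near \oo, a / n.+1%:R <= eta.
Proof.
move=> eta0; have := nbhs_infty_ger (a / eta); apply: filterS => n an.
rewrite ler_pdivrMr // mulrC -ler_pdivrMr // (le_trans an) //.
by rewrite ler_nat.
Qed.

Lemma near_ler_natM (R : realType) (a eta : R) : 0 < eta ->
  \forall n \near \oo, a <= eta * n%:R.
Proof.
move=> eta0; have := nbhs_infty_ger (a / eta); apply: filterS => n.
by rewrite ler_pdivrMr // mulrC.
Qed.

(** For a given [M], only finitely many pairs [(d, m)] have [d < size alpha] and [m < M], so they
    stop occurring. From then on [good_atom] bounds the deviation of every whole period. *)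
Lemma digits_unbiased (R : realType) e alpha : (0 < size alpha)%N ->
  (forall d m, (d < size alpha)%N -> \forall s \near \oo, e s <> Some (d, m)) ->
  smallo (deviation R alpha (digits e) 0).
Proof.
move=> j0 ev eta eta0.
(* Whole periods use up [eta / 2], split between the two terms of [good_atom]; the digits before
   [start s0] and the incomplete last period use [eta / 4] each. *)
have eta4 : 0 < eta / 4 by rewrite divr_gt0.
have [M _ HM] := near_half_expn eta4; have {HM} hM := HM M (leqnn M).
have : \forall s \near \oo, forall d : 'I_(size alpha), forall m : 'I_M,
    e s <> Some (d : nat, m : nat).
  by apply: filter_forall => d; apply: filter_forall => m; exact: ev.
move=> evM; have := near_divS (size alpha)%:R eta4 => hj.
have h1 := near_divS 1 eta4.
have hj' := nbhs_infty_ge (size alpha).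
have hM' := nbhs_infty_ge M.
have [s0 _ Hs] := filterI evM (filterI hj (filterI h1 (filterI hj' hM'))).
have atom s q : (s0 <= s)%N -> (start s <= q * period s)%N ->
    (q.+1 * period s <= start s.+1)%N ->
    `|deviation R alpha (digits e) (q * period s) (q.+1 * period s)| <=
      eta / 2 * (period s)%:R.
  move=> s0s q1 q2; have /= [A [B [_ [C D]]]] := Hs s s0s.
  apply: le_trans (good_atom (M := M) _ q1 q2 _ _ _) _.
  - by rewrite j0 (leq_trans C).
  - exact: leq_trans D _.
  - move=> d m esdm dj; rewrite leqNgt; apply/negP => mM.
    exact: A (Ordinal dj) (Ordinal mM) esdm.
  rewrite mulrC ler_wpM2r // (le_trans (lerD hM B)) //; lra.
have bound s q : (s0 <= s)%N -> (start s <= q * period s <= start s.+1)%N ->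
    `|deviation R alpha (digits e) 0 (q * period s)| <=
      (start s0)%:R + eta / 2 * (q * period s)%:R.
  move=> s0s sq; have e2 : 0 <= eta / 2 * (start s0)%:R.
    by rewrite mulr_ge0 // divr_ge0 // ltW.
  have := deviation_le R alpha (digits e) 0 (start s0).
  rewrite subn0 !ler_norml => /andP[lo hi]; apply/andP; split.
    have := stages_le (G := fun n => - deviation R alpha (digits e) 0 n)
       (eps := eta / 2) _ s0s sq.
    rewrite mulrBr => H; suff : - deviation R alpha (digits e) 0 (q * period s) <=
      - deviation R alpha (digits e) 0 (start s0) +
       (eta / 2 * (q * period s)%:R - eta / 2 * (start s0)%:R) by lra.
    apply: H => s' q' ss' q1 q2; have := atom _ _ ss' q1 q2.
    rewrite (@deviation0D _ _ _ (q' * period s')) ?leq_mul2r ?leqnSn ?orbT //.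
    by rewrite ler_norml => /andP[lo' hi']; lra.
  have := stages_le (G := fun n => deviation R alpha (digits e) 0 n)
       (eps := eta / 2) _ s0s sq.
  rewrite mulrBr => H; suff : deviation R alpha (digits e) 0 (q * period s) <=
      deviation R alpha (digits e) 0 (start s0) +
       (eta / 2 * (q * period s)%:R - eta / 2 * (start s0)%:R) by lra.
  apply: H => s' q' ss' q1 q2; have := atom _ _ ss' q1 q2.
  rewrite (@deviation0D _ _ _ (q' * period s')) ?leq_mul2r ?leqnSn ?orbT //.
  by rewrite ler_norml => /andP[lo' hi']; lra.
have [n0 _ Hn0] := filterI (near_ler_natM (start s0)%:R eta4) (nbhs_infty_ge (start s0)).
exists n0 => // n /Hn0 [/= n1 n2].
have /stage_exists [s /andP[sn nS]] : (start 0 <= n)%N.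
  exact: leq_trans (leq_start (leq0n _)) n2.
have s0s : (s0 <= s)%N.
  rewrite leqNgt; apply/negP => /leq_start /(leq_trans nS).
  by rewrite ltnNge n2.
have [_ [_ [C _]]] := Hs s s0s; rewrite /= in C.
have /dvdnP[q0 q0E] := period_dvd_start s.
have qn : (n %/ period s * period s <= n)%N by exact: leq_divM.
have qs : (start s <= n %/ period s * period s)%N.
  by rewrite q0E leq_mul2r leq_divRL ?period_gt0 // -q0E sn orbT.
have := bound s (n %/ period s)%N s0s; rewrite qs (leq_trans qn) ?(ltnW nS) //.
move=> /(_ isT) b.
rewrite (deviation0D _ _ _ qn) (le_trans (ler_normD _ _)) //.
have := deviation_le R alpha (digits e) (n %/ period s * period s) n.
have : (n - n %/ period s * period s)%:R <= (period s)%:R :> R.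
  by rewrite ler_nat leq_subLR {1}(divn_eq n (period s)) leq_add2l
             ltnW // ltn_mod period_gt0.
(* The incomplete period is negligible because [s.+1] periods already fit below [start s <= n]. *)
have : (period s)%:R <= eta / 4 * n%:R.
  have : (s.+1 * period s)%:R <= n%:R :> R.
    by rewrite ler_nat (leq_trans (leq_period_start _)).
  rewrite natrM => h.
  have : eta / 4 * (s.+1%:R * (period s)%:R) <= eta / 4 * n%:R.
    by rewrite ler_wpM2l // ltW.
  apply: le_trans; rewrite mulrA ler_peMl //.
  by rewrite -ler_pdivrMr.
have : eta / 2 * (n %/ period s * period s)%:R <= eta / 2 * n%:R.
  by rewrite ler_wpM2l ?ler_nat // divr_ge0 // ltW.
by lra.
Qed.

(** At the end of a biased stage [s], the loss over that stage is a fixed proportion of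
    [start s.+1], while everything before [start s] is negligible. This happens for arbitrarily
    large [s]. *)
Lemma digits_biased (R : realType) e d m :
  (forall B, exists2 s, (B <= s)%N & e s = Some (d, m)) ->
  ~ smallo (deviation R (rcons (nseq d false) true) (digits e) 0).
Proof.
set alpha := rcons _ _; move=> ev so.
set c : R := 2^-1 ^+ (m + d.+1).
have c0 : 0 < c by rewrite exprn_gt0.
have c8 : 0 < c / 8 by rewrite divr_gt0.
have [B _ HB] := filterI (filterI (so _ c8) (near_divS (2 * d.+1%:R) c8))
   (filterI (near_divS 2 c8) (filterI (nbhs_infty_ge d) (nbhs_infty_ge m))).
have [s Bs es] := ev B.
have /= [[_ h1] [h2 [ds ms]]] := HB s Bs.
have /= [[h3 _] _] : _ := HB (start s.+1)
  (leq_trans Bs (leq_trans (leqnSn s) (ltnW (ltn_start s.+1)))).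
have /dvdnP[q qE] := period_dvd_startS s.
(* By [bad_atom] each period loses [c] per digit up to an overflow of at most [c / 8]; the rate 3/4
   is a convenient weakening of 7/8. *)
have := @atoms_le R (deviation R alpha (digits e) 0) (- (3 / 4 * c)) s _ q.
rewrite -qE leqnn leq_start // => H.
have {}H := H _ isT.
have := deviation_le R alpha (digits e) 0 (start s); rewrite subn0.
move: h3; rewrite !ler_norml => /andP[h3 _] /andP[_ h4].
have : 2 * (start s)%:R <= c / 8 * (start s.+1)%:R.
  have : s.+1%:R * (start s)%:R <= (start s.+1)%:R :> R.
    rewrite -natrM ler_nat (leq_trans _ (leq_start_startS s)) //.
    by rewrite leq_mul2r leqnSn orbT.
  move=> h; have : c / 8 * (s.+1%:R * (start s)%:R) <= c / 8 * (start s.+1)%:R.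
    by rewrite ler_wpM2l // ltW.
  apply: le_trans; rewrite mulrA ler_wpM2r //.
  by rewrite -ler_pdivrMr.
have S0 : 0 < c * (start s.+1)%:R by rewrite mulr_gt0 // ltr0n start_gt0.
have c1 : c <= 1 by rewrite exprn_ile1 // invf_le1 ?ler1n.
have : c * (start s)%:R <= (start s)%:R by rewrite ler_piMl.
suff : deviation R alpha (digits e) 0 (start s.+1)
      <= deviation R alpha (digits e) 0 (start s) +
         - (3 / 4 * c) * ((start s.+1)%:R - (start s)%:R).
  rewrite mulrBr; lra.
apply: H => q' q1 q2.
rewrite (@deviation0D _ _ _ (q' * period s)) ?leq_mul2r ?leqnSn ?orbT //.
rewrite lerD2l (le_trans (bad_atom _ q1 q2 ds _ es)) //; first exact: leq_trans ms _.
rewrite mulrC ler_wpM2r // (le_trans (lerB h1 (lexx c))) //; lra.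
Qed.

(** * Normality of sequences *)

Lemma near_cantor_prefix (x : cantor_space) n :
  \forall y \near x, forall i, (i < n)%N -> y i = x i.
Proof.
have H : \forall y \near x, forall i : 'I_n, (y : cantor_space) (i : nat) = x (i : nat).
  apply: (@filter_forall _ _
    (fun i : 'I_n => [set y : cantor_space | y (i : nat) = x (i : nat)])
    (nbhs x)) => i.
  have /= := @proj_continuous nat (fun=> bool) i x [set x (i : nat)].
  by apply; exact: open_nbhs_nbhs (conj (discrete_open _) erefl).
by apply: filterS H => y yx i ni; exact: (yx (Ordinal ni)).
Qed.

Lemma cvg_cantor (F : set_system cantor_space) (x : cantor_space) :
  Filter F -> (forall n, \forall y \near F, y n = x n) -> F --> x.
Proof.
move=> FF Fx; apply/cvg_sup => i A [B [[C oC <-] Cx] BA].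
by apply: filterS (Fx i) => y yx; apply: BA; rewrite /= /proj yx.
Qed.

Lemma closed_prefix_dependent n (P : cantor_space -> Prop) :
  (forall x y : cantor_space, (forall i, (i < n)%N -> y i = x i) -> P y -> P x) ->
  closed [set x | P x].
Proof.
move=> Pn x /(_ _ (near_cantor_prefix x n)) [y [/= Py yx]].
exact: Pn Py.
Qed.

Lemma mkseq_take (T : Type) (x : nat -> T) m n :
  (m <= n)%N -> take m (mkseq x n) = mkseq x m.
Proof.
by move=> mn; rewrite /mkseq -map_take take_iota; congr (map _ (iota _ _)); lia.
Qed.

Lemma suffix_restr alpha (x : nat -> bool) i :
  suffix alpha (mkseq x (i + size alpha)) = occurs alpha x i.
Proof.
rewrite suffixE size_mkseq addnK /occurs /mkseq -map_drop drop_iota add0n addKn.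
by rewrite -[X in iota X]addn0 iotaDl -map_comp.
Qed.

Lemma occ_density_restr (R : realType) alpha x n :
  occ_density R alpha (restr x n) =
  (\sum_(0 <= i < n - size alpha) occurs alpha x i)%N%:R / n%:R.
Proof.
rewrite /occ_density /restr size_mkseq big_mkord; congr (_%:R / _).
apply: eq_bigr => i _; rewrite mkseq_take ?suffix_restr //.
by have := ltn_ord i; lia.
Qed.

(** The density counts starts below [n - size alpha], the deviation counts starts below [n]: at most
    [size alpha] occurrences separate them. *)
Lemma occ_density_deviation (R : realType) alpha x n :
  `|n%:R * (occ_density R alpha (restr x n) - 2^-1 ^+ size alpha)
    - deviation R alpha x 0 n| <= (size alpha)%:R.
Proof.
have [->|n0] := posnP n.
  by rewrite /deviation big_geq // mul0r subr0 normr0.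
have nR : n%:R != 0 :> R by rewrite pnatr_eq0 -lt0n.
rewrite occ_density_restr mulrBr mulrCA divff // mulr1.
rewrite /deviation sumrB sumr_const_nat subn0 -natr_sum.
rewrite [\sum_(0 <= i < n) _](@big_cat_nat _ _ _ (n - size alpha)) ?leq_subr //=.
rewrite natrD mulr_natl; set a := (\sum_(0 <= i < _) _)%:R; set b := (\sum_(_ <= i < n) _)%:R.
set c := _ *+ _.
have -> : a - c - (a + b - c) = - b by ring.
rewrite normrN ger0_norm // ler_nat.
rewrite (@leq_trans (\sum_(n - size alpha <= i < n) 1)%N) //.
  by apply: leq_sum => i _; exact: leq_b1.
by rewrite sum_nat_const_nat; lia.
Qed.

Definition normal_seq (R : realType) k (x : cantor_space) : Prop :=
  forall alpha : k.-tuple bool,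
    occ_density R alpha (restr x s) @[s --> \oo] --> (2^-1 ^+ k : R).

Lemma occ_density_cvgP (R : realType) alpha x :
  occ_density R alpha (restr x s) @[s --> \oo] --> (2^-1 ^+ size alpha : R)
  <-> smallo (deviation R alpha x 0).
Proof.
split=> [/cvgrPdist_le h eta eta0|h].
  have e2 : 0 < eta / 2 by rewrite divr_gt0.
  have [n0 _ Hn0] := filterI (h _ e2) (near_ler_natM (size alpha)%:R e2).
  exists n0 => // n /Hn0 [/= n1 n2].
  have := occ_density_deviation R alpha x n; set d := _ - 2^-1 ^+ _.
  rewrite distrC -/d in n1 => h3.
  have : `|n%:R * d| <= n%:R * (eta / 2) by rewrite normrM normr_nat ler_wpM2l.
  move: h3 n2; rewrite !ler_norml => /andP[a b] c /andP[p q].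
  by apply/andP; split; lra.
apply/cvgrPdist_le => eta eta0; have e2 : 0 < eta / 2 by rewrite divr_gt0.
have [n0 _ Hn0] := filterI (h _ e2) (filterI (near_ler_natM (size alpha)%:R e2)
  (nbhs_infty_gt 0)).
exists n0 => // n /Hn0 [/= n1 [n2 n3]].
have := occ_density_deviation R alpha x n; set d := _ - 2^-1 ^+ _.
rewrite -/d => h3; have n0R : 0 < n%:R :> R by rewrite ltr0n.
rewrite distrC -/d -(ler_pM2l n0R) -{1}(normr_nat R n) -normrM.
move: h3 n1; rewrite !ler_norml => /andP[a b] /andP[p q].
by apply/andP; split; lra.
Qed.

Lemma normal_seqP (R : realType) k x : normal_seq R k x <->
  forall alpha : k.-tuple bool, smallo (deviation R alpha x 0).
Proof.
by split=> h alpha; have := occ_density_cvgP R alpha x; rewrite size_tuple => -[];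
  move=> H1 H2; [apply: H1|apply: H2]; exact: h.
Qed.

Lemma smalloD (R : realType) (u v w : nat -> R) : (forall n, w n = u n + v n) ->
  smallo u -> smallo v -> smallo w.
Proof.
move=> wE hu hv eta eta0; have e2 : 0 < eta / 2 by rewrite divr_gt0.
have [n0 _ Hn0] := filterI (hu _ e2) (hv _ e2).
exists n0 => // n /Hn0 [/= n1 n2]; rewrite wE (le_trans (ler_normD _ _)) //.
lra.
Qed.

Lemma occurs_rcons alpha b x i :
  occurs (rcons alpha b) x i = occurs alpha x i && (x (i + size alpha)%N == b).
Proof. by rewrite /occurs size_rcons /mkseq -addn1 iotaD map_cat /= cats1 eqseq_rcons. Qed.

(** Each occurrence of [alpha] extends by exactly one of the two digits, so the deviation of [alpha]
    is the sum of those of its two extensions. *)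
Lemma normal_seqS (R : realType) k x : normal_seq R k.+1 x -> normal_seq R k x.
Proof.
rewrite !normal_seqP => h alpha.
have ext b : smallo (deviation R (rcons alpha b) x 0).
  by have := h [tuple of rcons alpha b].
apply: smalloD (ext true) (ext false) => n.
rewrite /deviation -big_split /=; apply: eq_bigr => i _.
rewrite !occurs_rcons !size_rcons exprS.
by case: occurs; case: (x _) => /=; lra.
Qed.

(** If [b] stopped occurring, the density of the word of [k] letters [b] would tend to 0, below
    [2^-1 ^+ k - eta]. A fixed tolerance suffices, which is what membership needs. *)
Lemma density_near_recurs (R : realType) k b (x : cantor_space) (eta : R) n1 :
  (0 < k)%N -> eta < 2^-1 ^+ k ->
  (forall s, (n1 <= s)%N ->
    `|occ_density R (nseq k b) (restr x s) - 2^-1 ^+ k| <= eta) ->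
  forall n0, exists2 i, (n0 <= i)%N & x i = b.
Proof.
move=> k0 etak hx n0; apply: contrapT => no.
have xb i : (n0 <= i)%N -> occurs (nseq k b) x i = false.
  move=> n0i; apply/negP => /occursP /(_ 0%N); rewrite size_nseq => /(_ k0).
  by rewrite addn0 nth_nseq k0 => xi; apply: no; exists i.
have d0 : 0 < (2^-1 ^+ k - eta) / 2 by rewrite divr_gt0 // subr_gt0.
have [n2 _ Hn2] := filterI (near_ler_natM n0%:R d0)
  (filterI (nbhs_infty_ge n1) (nbhs_infty_gt 0)).
have /= [h1 [h2 h3]] := Hn2 n2 (leqnn _).
have n2R : 0 < n2%:R :> R by rewrite ltr0n.
have := hx _ h2; rewrite occ_density_restr ler_norml => /andP[h _].
have : (\sum_(0 <= i < n2 - size (nseq k b)) occurs (nseq k b) x i)%N%:R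
    <= n0%:R :> R.
  rewrite ler_nat; set N := (n2 - _)%N.
  apply: (@leq_trans (\sum_(0 <= i < N) (i < n0))%N).
    apply: leq_sum => i _; have [n0i|] := leqP n0 i; first by rewrite xb.
    by rewrite leq_b1.
  have [Nn|nN] := leqP N n0.
    apply: leq_trans Nn; rewrite -[leqRHS]subn0 -[leqRHS]muln1 -sum_nat_const_nat.
    by apply: leq_sum => i _; exact: leq_b1.
  by rewrite big_mkord sum_ord_lt // ltnW.
rewrite -[X in X <= n0%:R](divfK (lt0r_neq0 n2R)).
set o := _ / n2%:R in h *; set p := _ ^+ k in etak d0 h1 h * => h4.
have h5 : p - eta <= o by lra.
have : (p - eta) * n2%:R <= o * n2%:R by rewrite ler_wpM2r // ltW.
have : 0 < (p - eta) * n2%:R by rewrite mulr_gt0 // subr_gt0.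
by lra.
Qed.

(** * Binary expansions and membership *)

Definition shift n (x : cantor_space) : cantor_space := fun i => x (n + i)%N.

Definition binary_frac (R : realType) (x : cantor_space) : R := binary_real R 0 x.

Lemma binary_realE (R : realType) a x : binary_real R a x = a%:~R + binary_frac R x.
Proof. by rewrite /binary_frac /binary_real mulr0z add0r. Qed.

Lemma partial_frac_le1 (R : realType) (x : cantor_space) n :
  series (fun n => (x n)%:R * 2^-1 ^+ n.+1 : R) n <= 1 - 2^-1 ^+ n.
Proof.
elim: n => [|n IH]; first by rewrite /series /= big_geq // expr0 subrr.
rewrite /series /= big_nat_recr //=.
apply: le_trans (lerD IH (_ : _ <= 2^-1 ^+ n.+1)) _.
  by rewrite ler_piMl ?exprn_ge0 //; case: (x n).
by rewrite exprS; lra.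
Qed.

Lemma cvg_frac (R : realType) (x : cantor_space) :
  series (fun n => (x n)%:R * 2^-1 ^+ n.+1 : R) @ \oo --> binary_frac R x.
Proof.
rewrite /binary_frac /binary_real mulr0z add0r.
apply: nondecreasing_is_cvgn.
  by apply: nondecreasing_series => n _ _; rewrite mulr_ge0 // exprn_ge0.
exists 1 => _ [n _ <-]; rewrite (le_trans (partial_frac_le1 _ _ _)) //.
Qed.

Lemma frac_ge0 (R : realType) x : 0 <= binary_frac R x.
Proof.
rewrite -(cvg_lim _ (@cvg_frac R x)) //; apply: limr_ge.
  by apply/cvg_ex; exists (binary_frac R x); exact: cvg_frac.
by apply: nearW => n; apply: sumr_ge0 => i _; rewrite mulr_ge0 // exprn_ge0.
Qed.

Lemma frac_le1 (R : realType) x : binary_frac R x <= 1.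
Proof.
rewrite -(cvg_lim _ (@cvg_frac R x)) //; apply: limr_le.
  by apply/cvg_ex; exists (binary_frac R x); exact: cvg_frac.
apply: nearW => n; rewrite (le_trans (partial_frac_le1 _ _ _)) //.
Qed.

Lemma frac_rec (R : realType) (x : cantor_space) :
  binary_frac R x = ((x 0%N)%:R + binary_frac R (shift 1 x)) / 2.
Proof.
have := @cvg_frac R x; rewrite -cvg_shiftS => h1.
set u := series _ in h1; set v := series (fun n => (shift 1 x n)%:R * 2^-1 ^+ n.+1 : R).
have E : (fun n => u n.+1) = (fun n => ((x 0%N)%:R + v n) / 2).
  apply/funext => n; rewrite /u /v /series /= big_nat_recl //= expr1 mulrDl mulr_suml.
  congr (_ + _); apply: eq_bigr => i _.
  by rewrite /shift add1n [in LHS]exprSr mulrA.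
have h2 : (fun n => u n.+1) @ \oo --> ((x 0%N)%:R + binary_frac R (shift 1 x)) / 2.
  by rewrite E; apply: cvgMl; apply: cvgD; [exact: cvg_cst|exact: cvg_frac].
exact: (cvg_unique _ h1 h2).
Qed.

Lemma frac_gt0 (R : realType) (x : cantor_space) i : x i -> 0 < binary_frac R x.
Proof.
elim: i x => [|i IH] x xi; rewrite frac_rec.
  by rewrite xi divr_gt0 // ltr_pwDl // frac_ge0.
by rewrite divr_gt0 // ltr_wpDl //; apply: IH; rewrite /shift add1n.
Qed.

Lemma frac_lt1 (R : realType) (x : cantor_space) i : x i = false -> binary_frac R x < 1.
Proof.
elim: i x => [|i IH] x xi; rewrite frac_rec.
  by rewrite xi add0r; have := frac_le1 R (shift 1 x); lra.
have : binary_frac R (shift 1 x) < 1 by apply: IH; rewrite /shift add1n.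
by have : (x 0%N)%:R <= 1 :> R by [case: (x 0%N)]; lra.
Qed.

Lemma frac_prefix (R : realType) n (x y : cantor_space) :
  (forall i, (i < n)%N -> y i = x i) -> `|binary_frac R x - binary_frac R y| <= 2^-1 ^+ n.
Proof.
elim: n x y => [|n IH] x y xy.
  have := frac_ge0 R x; have := frac_ge0 R y.
  have := frac_le1 R x; have := frac_le1 R y.
  by rewrite expr0 ler_norml => *; apply/andP; split; lra.
rewrite (frac_rec _ x) (frac_rec _ y) xy // -mulrBl.
have -> : (x 0%N)%:R + binary_frac R (shift 1 x) - ((x 0%N)%:R + binary_frac R (shift 1 y))
   = binary_frac R (shift 1 x) - binary_frac R (shift 1 y) by ring.
rewrite normrM exprSr [X in _ * X]ger0_norm ?invr_ge0 // ler_wpM2r ?invr_ge0 //.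
by apply: IH => i ni; rewrite /shift add1n xy.
Qed.

Lemma continuous_frac (R : realType) : continuous (@binary_frac R).
Proof.
move=> x; apply/cvgrPdist_le => eta eta0.
have [n _ /(_ n (leqnn n)) /= Hn] := near_half_expn eta0.
apply: filterS (near_cantor_prefix x n) => y /(frac_prefix R).
by move=> /le_trans; exact.
Qed.

(** Not eventually constant; this excludes the double expansions of dyadic rationals. *)
Definition recurrent (x : cantor_space) : Prop :=
  forall b n0, exists2 i, (n0 <= i)%N & x i = b.

Lemma recurrent_frac (R : realType) n x : recurrent x ->
  0 < binary_frac R (shift n x) < 1.
Proof.
move=> rx; apply/andP; split.
  have [i ni xi] := rx true n.
  by apply: (@frac_gt0 _ _ (i - n)); rewrite /shift subnKC.
have [i ni xi] := rx false n.
by apply: (@frac_lt1 _ _ (i - n)); rewrite /shift subnKC.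
Qed.

(** The integer [a - b] equals [w - v], which is strictly between -1 and 1 even when [w] is an
    endpoint. Hence in comparing two expansions only one has to be recurrent. *)
Lemma int_part_unique (R : realType) (a b : int) (v w : R) :
  0 < v < 1 -> 0 <= w <= 1 -> a%:~R + v = b%:~R + w -> a = b.
Proof.
move=> /andP[v0 v1] /andP[w0 w1] ab.
have : a%:~R < (b + 1)%:~R :> R by rewrite intrD; lra.
have : b%:~R < (a + 1)%:~R :> R by rewrite intrD; lra.
by rewrite !ltr_int; lia.
Qed.

(** Doubling turns the leading digit into an integer part, which is unique because the tails of [x]
    have values strictly between 0 and 1; then one passes to the tails. *)
Lemma frac_inj (R : realType) x y : recurrent x -> binary_frac R x = binary_frac R y -> x = y.
Proof.
move=> rx xy.
have step n : binary_frac R (shift n x) = binary_frac R (shift n y) -> x n = y n /\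
    binary_frac R (shift n.+1 x) = binary_frac R (shift n.+1 y).
  rewrite (frac_rec _ (shift n x)) (frac_rec _ (shift n y)).
  have sS z : shift 1 (shift n z) = shift n.+1 z.
    by apply/funext => i; rewrite /shift addnA addn1.
  rewrite !sS /shift addn0 => h.
  have h' : (x n)%:R + binary_frac R (shift n.+1 x) = (y n)%:R + binary_frac R (shift n.+1 y).
    by lra.
  have := @int_part_unique R (Posz (x n)) (Posz (y n)) _ _
     (recurrent_frac R n.+1 rx) _ h'.
  rewrite frac_ge0 frac_le1 => /(_ isT) xyn.
  have {}xyn : x n = y n by case: (x n) (y n) xyn => [] [].
  by split => //; move: h'; rewrite xyn; lra.
have all n : binary_frac R (shift n x) = binary_frac R (shift n y).
  elim: n => [|n IH]; last by have [] := step n IH.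
  by rewrite (_ : shift 0 x = x) // (_ : shift 0 y = y).
by apply/funext => n; have [] := step n (all n).
Qed.

Lemma normal_seq_recurrent (R : realType) k x : (0 < k)%N ->
  normal_seq R k x -> recurrent x.
Proof.
move=> k0 nx b; have p0 : 0 < 2^-1 ^+ k / 2 :> R by rewrite divr_gt0 // exprn_gt0.
have /cvgrPdist_le /(_ _ p0) [n1 _ Hn1] := nx [tuple of nseq k b].
apply: (@density_near_recurs R k b x (2^-1 ^+ k / 2) n1) => // [|s /Hn1 /=].
  by move: p0; lra.
by rewrite distrC.
Qed.

(** A normal expansion is recurrent, so its fractional part is strictly between 0 and 1, and a value
    in [0,1] leaves only the integer part 0. *)
Lemma order_normal_setP (R : realType) k r : (0 < k)%N ->
  order_normal_set R k r <-> exists2 x, r = binary_frac R x & normal_seq R k x.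
Proof.
move=> k0; split=> [[/andP[r0 r1] [a [x [rE nx]]]]|[x -> nx]]; last first.
  by split; [rewrite frac_ge0 frac_le1|exists 0, x].
exists x => //; have rx := normal_seq_recurrent k0 nx.
have := recurrent_frac R 0 rx; rewrite (_ : shift 0 x = x) // => hx.
rewrite rE binary_realE (_ : a = 0) ?mulr0z ?add0r //.
apply: (@int_part_unique R a 0 (binary_frac R x) r) => //; first by rewrite r0.
by rewrite mulr0z add0r rE binary_realE.
Qed.

Lemma order_normal_set_frac (R : realType) k x : (0 < k)%N ->
  order_normal_set R k (binary_frac R x) <-> normal_seq R k x.
Proof.
move=> k0; rewrite order_normal_setP //; split=> [[y xy ny]|nx]; last by exists x.
by rewrite -(frac_inj (normal_seq_recurrent k0 ny) (esym xy)).
Qed.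

Lemma order_normal_setS (R : realType) k : (0 < k)%N ->
  order_normal_set R k.+1 `<=` order_normal_set R k.
Proof.
move=> k0 r /order_normal_setP [] // x rx /normal_seqS nx.
by apply/order_normal_setP => //; exists x.
Qed.

(** * Order-k normality as an intersection of unions of closed sets *)

Definition tolerant_set (R : realType) k m n : set cantor_space :=
  [set x | forall s (alpha : k.-tuple bool), (n <= s)%N ->
     `|occ_density R alpha (restr x s) - 2^-1 ^+ k| <= m.+1%:R^-1].

Lemma closed_tolerant_set (R : realType) k m n : closed (tolerant_set R k m n).
Proof.
have -> : tolerant_set R k m n = \bigcap_(s in [set s | (n <= s)%N])
  [set x | forall alpha : k.-tuple bool,
     `|occ_density R alpha (restr x s) - 2^-1 ^+ k| <= m.+1%:R^-1].
  by apply/seteqP; split=> x H s => [ns alpha|alpha ns]; exact: H.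
apply: closed_bigI => s _; apply: (@closed_prefix_dependent s) => x y yx Hy alpha.
have -> : restr x s = restr y s; last exact: Hy.
by apply: (@eq_from_nth _ false); rewrite !size_mkseq // => i si;
   rewrite !nth_mkseq // yx.
Qed.

Lemma closed_frac_image (R : realType) (A : set cantor_space) :
  closed A -> closed (binary_frac R @` A).
Proof.
move=> cA; apply: compact_closed; first exact: Rhausdorff.
apply: continuous_compact; first exact: continuous_subspaceT (@continuous_frac R).
exact: subclosed_compact cA cantor_space_compact _.
Qed.

Lemma Pi03_order_normal_set (R : realType) k : (0 < k)%N ->
  Pi03 (order_normal_set R k).
Proof.
move=> k0; exists (fun m n => binary_frac R @` tolerant_set R k m n); split.
  by move=> m n; apply: closed_frac_image; exact: closed_tolerant_set.
apply/seteqP; split=> [r /order_normal_setP [] // x -> nx m _|r Hr].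
  have m0 : 0 < m.+1%:R^-1 :> R by rewrite invr_gt0.
  have : \forall s \near \oo, forall alpha : k.-tuple bool,
      `|occ_density R alpha (restr x s) - 2^-1 ^+ k| <= m.+1%:R^-1.
    apply: filter_forall => alpha; have /cvgrPdist_le /(_ _ m0) := nx alpha.
    by apply: filterS => s; rewrite distrC.
  by move=> [n _ Hn]; exists n => //; exists x => // s alpha ns; exact: Hn.
have p0 : 0 < 2^-1 ^+ k / 2 :> R by rewrite divr_gt0 // exprn_gt0.
have [M _ HM] := near_divS 1 p0.
have rec m n x : (M <= m)%N -> tolerant_set R k m n x -> recurrent x.
  move=> /HM /=; rewrite div1r => mM tx b.
  apply: (@density_near_recurs R k b x m.+1%:R^-1 n) => // [|s ns].
    by apply: le_lt_trans mM _; move: p0; lra.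
  exact: (tx s [tuple of nseq k b] ns).
(* The expansion found at tolerance index [M] is recurrent, so an expansion of [r] found at any
   other tolerance must coincide with it. *)
have [n0 _ [x tx xr]] := Hr M I.
apply/order_normal_setP => //; exists x => // alpha.
apply/cvgrPdist_le => eta eta0.
have [m1 _ Hm1] := near_divS 1 eta0.
have [n1 _ [y ty yr]] := Hr (maxn M m1) I.
have xy : x = y.
  by apply: (frac_inj (R := R) (rec _ _ _ (leqnn M) tx)); rewrite xr yr.
exists n1 => // s /= ns; rewrite distrC xy (le_trans (ty s alpha ns)) //.
by have := Hm1 (maxn M m1) (leq_maxr _ _); rewrite /= div1r.
Qed.

(** * The reduction *)

(** Otherwise points of [A] sharing longer and longer prefixes with [x] would converge to [x]. *)
Lemma closed_prefix_separated (A : set cantor_space) (x : cantor_space) :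
  closed A -> ~ A x ->
  exists t, forall z, A z -> exists2 j, (j < t)%N & z j <> x j.
Proof.
move=> cA nAx; apply: contrapT => no; apply: nAx.
have /choice [z Hz] : forall t, exists z, A z /\ forall j, (j < t)%N -> z j = x j.
  move=> t; apply: contrapT => nz; apply: no; exists t => z Az.
  apply: contrapT => nj; apply: nz; exists z; split => // j jt.
  by apply: contrapT => zj; apply: nj; exists j.
apply: (@closed_cvg _ _ \oo _ z A cA) => //.
  by apply: nearW => t; have [] := Hz t.
apply: cvg_cantor => n; exists n.+1 => // t /= nt.
by have [_] := Hz t; exact.
Qed.

(** The cylinder given by the first [t] digits of [x] avoids [F d m i] for all [i <= n]. Only these
    digits of [x] matter, which later yields continuity. *)
Definition misses (F : nat -> nat -> nat -> set cantor_space)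
    (x : cantor_space) d m n t : Prop :=
  forall i z, (i <= n)%N -> F d m i z -> exists2 j, (j < t)%N & z j <> x j.

Definition first_miss F x d m n t : Prop :=
  misses F x d m n t /\ forall t', misses F x d m n t' -> (t <= t')%N.

(* Each n contributes at most one stage, so the events of type (d, m) are
   infinite in number iff x avoids every F d m i. *)
Definition event F (x : cantor_space) (s : nat) : option (nat * nat) :=
  if CodeSeq.decode s is [:: d; m; n; t] then
    if `[< first_miss F x d m n t >] then Some (d, m) else None
  else None.

Lemma eventP F x s d m : event F x s = Some (d, m) <->
  exists n t, s = CodeSeq.code [:: d; m; n; t] /\ first_miss F x d m n t.
Proof.
split=> [|[n [t [-> fm]]]]; last by rewrite /event CodeSeq.codeK asboolT.
rewrite /event; case E: (CodeSeq.decode s) => [|a [|b [|n [|t []]]]] //.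
case: asboolP => // fm [<- <-]; exists n, t; split=> //.
by rewrite -E CodeSeq.decodeK.
Qed.

(** An entry of a list is smaller than the code of the list, so the event at [s] inspects only
    [t < s] digits. *)
Lemma event_prefix F x y s : (forall i, (i < s)%N -> y i = x i) ->
  event F y s = event F x s.
Proof.
move=> xy; rewrite /event.
case E: (CodeSeq.decode s) => [|d [|m [|n [|t []]]]] //.
have ts : (t < s)%N.
  by have := CodeSeq.ltn_code (CodeSeq.decode s);
     rewrite CodeSeq.decodeK E /= => /and5P[].
have M t' : (t' <= t)%N -> misses F y d m n t' <-> misses F x d m n t'.
  move=> tt; split=> H i z ni Fz; have [j jt zj] := H i z ni Fz; exists j => //.
    by rewrite -xy //; lia.
  by rewrite xy //; lia.
have half u v : (forall t', (t' <= t)%N -> misses F u d m n t' <-> misses F v d m n t') ->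
    first_miss F u d m n t -> first_miss F v d m n t.
  move=> uv [mt H]; split=> [|t' mt']; first exact/uv.
  rewrite leqNgt; apply/negP => t't; have := H t' (proj2 (uv _ (ltnW t't)) mt').
  by rewrite leqNgt t't.
suff -> : `[< first_miss F y d m n t >] = `[< first_miss F x d m n t >] by [].
by apply: asbool_equiv_eq; split; apply: half => t' /M; tauto.
Qed.

(** An event with [n >= i] would separate [x] from itself, and each of the finitely many [n < i]
    yields at most one stage, since the least [t] is unique. *)
Lemma event_finite F x d m i : F d m i x -> \forall s \near \oo, event F x s <> Some (d, m).
Proof.
move=> Fx.
have : \forall s \near \oo, forall n : 'I_i,
    ~ exists t, s = CodeSeq.code [:: d; m; (n : nat); t] /\ first_miss F x d m n t.
  apply: filter_forall => n.
  have [[t ft]|no] := pselect (exists t, first_miss F x d m n t); last first.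
    by apply: nearW => s [t [_ ft]]; apply: no; exists t.
  exists (CodeSeq.code [:: d; m; (n : nat); t]).+1 => // s /= ts [t' [sE ft']].
  have tt : t = t' by apply/eqP; rewrite eqn_leq (ft.2 _ ft'.1) (ft'.2 _ ft.1).
  by move: ts; rewrite sE tt ltnn.
apply: filterS => s H /eventP[n [t [sE ft]]].
have [ni|ni] := ltnP n i; first by apply: (H (Ordinal ni)); exists t.
by have [j _] := ft.1 i x ni Fx.
Qed.

(** Take [n = B]: the finitely many closed sets with index at most [B] are separated from [x] by a
    common prefix, and the code of a list containing [B] exceeds [B]. *)
Lemma event_infinite F x d m :
  (forall i, closed (F d m i)) -> (forall i, ~ F d m i x) ->
  forall B, exists2 s, (B <= s)%N & event F x s = Some (d, m).
Proof.
move=> cF nF B.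
have : \forall t \near \oo, forall i : 'I_B.+1, forall z,
    F d m i z -> exists2 j, (j < t)%N & z j <> x j.
  apply: filter_forall => i.
  have [t ht] := closed_prefix_separated (cF i) (nF i).
  exists t => // t' /= tt' z /ht [j jt zj]; exists j => //.
  exact: leq_trans jt tt'.
move=> [t0 _ Ht0].
have ex : exists t, `[< misses F x d m B t >].
  exists t0; apply/asboolP => i z iB; exact: (Ht0 t0 (leqnn _) (Ordinal (iB : i < B.+1)%N)).
case: (ex_minnP ex) => t /asboolP mt tmin.
exists (CodeSeq.code [:: d; m; B; t]).
  by have /= /and5P[_ _ /ltnW] := CodeSeq.ltn_code [:: d; m; B; t].
apply/eventP; exists B, t; split=> //; split=> // t' mt'.
by apply: tmin; apply/asboolP.
Qed.

(** Digit [n] depends only on the event at [stage n], hence on finitely many digits of the input. *)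
Lemma continuous_digits_event F :
  continuous (fun y => digits (event F y) : cantor_space).
Proof.
move=> x; apply: cvg_cantor => n.
apply: filterS (near_cantor_prefix x (stage n)) => y yx.
by rewrite /= /digits (event_prefix F yx).
Qed.

(** The indices are shifted by one: events [(d, m)] watch [A d.+1] and spoil a pattern of length
    [d.+1]. If [x] is in [A k], monotonicity puts it in [A d.+1] for all [d < k], so each event that
    could harm patterns of length [k] occurs finitely often. *)
Lemma normal_seq_digits (R : realType) F (A : nat -> set cantor_space) :
  (forall d m i, closed (F d m i)) ->
  (forall d, A d.+1 = \bigcap_m \bigcup_i F d m i) ->
  (forall k, (0 < k)%N -> A k.+1 `<=` A k) ->
  forall k x, (0 < k)%N -> normal_seq R k (digits (event F x)) <-> A k x.
Proof.
move=> cF AF Adec k x k0; split=> [nx|Akx].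
  case: k k0 nx => // d _ /normal_seqP nx; rewrite AF => m _.
  apply: contrapT => nF.
  have nF' i : ~ F d m i x by move=> Fi; apply: nF; exists i.
  have sz : size (rcons (nseq d false) true) == d.+1 by rewrite size_rcons size_nseq.
  exact: (digits_biased (event_infinite (cF d m) nF') (nx (Tuple sz))).
have Adx d : (d < k)%N -> A d.+1 x.
  move=> dk; move: Akx; rewrite -(subnKC dk).
  elim: (k - d.+1)%N => [|n IH]; first by rewrite addn0.
  by rewrite addnS => /(Adec _ (ltn0Sn _)); exact: IH.
apply/normal_seqP => alpha; apply: digits_unbiased; rewrite size_tuple //.
move=> d m /Adx; rewrite AF => /(_ m I) [i _]; exact: event_finite.
Qed.

Lemma frac_reduction (R : realType) (A : nat -> set cantor_space) :
  (forall k, (0 < k)%N -> Pi03 (A k)) ->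
  (forall k, (0 < k)%N -> A k.+1 `<=` A k) ->
  exists f : cantor_space -> R, continuous f /\
    forall k, (0 < k)%N -> f @^-1` order_normal_set R k = A k.
Proof.
move=> PA Adec.
have /choice [F HF] : forall d, exists F : nat -> nat -> set cantor_space,
    (forall m n, closed (F m n)) /\ A d.+1 = \bigcap_m \bigcup_n F m n.
  by move=> d; exact: PA.
exists (fun y => binary_frac R (digits (event F y))); split.
  move=> x; apply: (@continuous_comp _ _ _
    (fun y => digits (event F y) : cantor_space) (@binary_frac R)).
    exact: continuous_digits_event.
  exact: continuous_frac.
move=> k k0; apply/seteqP.
have H x : order_normal_set R k (binary_frac R (digits (event F x))) <-> A k x.
  rewrite order_normal_set_frac //; apply: normal_seq_digits => // d.
    by have [] := HF d.
  by have [] := HF d.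
by split=> x /H.
Qed.

Theorem theorem2 (R : realType) :
  complete_for Domega_Pi03
    (\bigcup_k (order_normal_set R (2 * k + 1)%N
                `\` order_normal_set R (2 * k + 2)%N)).
Proof.
split.
  exists (order_normal_set R); split=> // k k0.
    exact: Pi03_order_normal_set.
  exact: order_normal_setS.
move=> Y [A [PA Adec ->]]; have [f [cf fA]] := frac_reduction R PA Adec.
exists f; split=> //; rewrite preimage_bigcup; apply: eq_bigcupr => k _.
rewrite -(fA (2 * k + 1)%N) ?addn1 // -(fA (2 * k + 2)%N) ?addn2 //.
Qed.
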